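(* Let $p>7$ be a prime and let $A\subseteq F_p=\mathbb{Z}/p\mathbb{Z}$ with $|A|\geqslant\sqrt{4p-7}$. Let $n=\lfloor |A|/2\rfloor$ and $a_1,\ldots,a_n\in F_p^*$. Then every element of $F_p$ can be written in the linear form $a_1x_1+\cdots+a_nx_n$ with $x_1,\ldots,x_n\in A$ distinct.
   Context: $F_p^*=F_p\setminus\{0\}$. *)

(* Defs.v *)
From mathcomp Require Export all_boot all_order all_algebra.

#[global] Set Implicit Arguments.
#[global] Unset Strict Implicit.
#[global] Unset Printing Implicit Defensive.

(* Main.v *)
Require Import Defs.
From mathcomp Require Import all_boot all_order all_algebra.
From mathcomp Require Import all_fingroup all_field zify ring.

Import GRing.Theory Num.Theory.
Local Open Scope ring_scope.

(** The proof is by the polynomial method.  Put [k = |A|].  If some [c] is not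
    a value of the form [a_1 x_1 + ... + a_n x_n] at distinct points of [A],
    then by Fermat's little theorem the polynomial
      [det (x_i ^ j) * ((a_1 x_1 + ... + a_n x_n - c) ^ (p - 1) - 1)]
    vanishes on [A ^ n], the Vandermonde determinant taking care of the points
    with a repeated coordinate.  Hence the coefficient of each monomial
    [x_1 ^ e_1 ... x_n ^ e_n] of top degree [p - 1 + 'C(n, 2)] with all
    [e_i < k] is zero.  Up to nonzero factors and the factorials [e_i !] this
    coefficient is
      [(p - 1)! * det (b_i ^ j * e_i (e_i - 1) ... (e_i - j + 1))]
    with [b_i = 1 / a_i] ([exists_pow_neq1]), so it suffices to find exponents
    [e_i < k] with the right sum that make this determinant nonzero in [F_p].

    Such exponents are found by induction from [n - 2] to [n]
    ([exists_exponents]).  As [p] is odd and the [b_i] are nonzero, among any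
    three of them two have a nonzero sum, say [b_0] and [b_1].  Fix
    [e_0 + e_1 = s] and the other [e_i].  The determinant is then a polynomial
    in [e_0] of degree at most [2 n - 3], whose coefficient in that degree is
      [+- (b_0 b_1) ^ (n - 2) * (b_0 + b_1)]
    times the determinant belonging to the other [n - 2] rows.  Hence one of
    any [2 n - 2] values of [e_0] that are distinct in [F_p] will do, and there
    are that many admissible values because [k >= 2 n - 2] and [s] is kept
    between [2 n - 3] and [2 k - 2 n + 1].  The case of two opposite [b_i] left at the
    end is harmless: the determinant is then [b_0 (e_0 + e_1)], and [e_0 + e_1]
    lies strictly between [0] and [p].

    The sum of the exponents is attainable as soon as [p - 1 <= n (k - n)].
    With [n] the half of [k], the hypothesis on [k] gives this inequality
    except when [k ^ 2 = 4 p - 7], which no odd [p] allows modulo 8. *)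

(** * Falling factorials and their determinants *)

(** The columns are listed by decreasing exponent, so that deleting the first
    two rows and the first two columns leaves a matrix of the same shape. *)
Definition falling_mx (F : fieldType) n (b : 'I_n -> F) (e : 'I_n -> nat) :
    'M[F]_n :=
  \matrix_(i, j) (b i ^+ rev_ord j * (e i ^_ rev_ord j)%:R).

Lemma natr_ffact (F : fieldType) (x m : nat) :
  (x ^_ m)%:R = \prod_(l < m) (x%:R - l%:R) :> F.
Proof.
elim: m => [|m IHm]; first by rewrite big_ord0.
rewrite big_ord_recr /= -IHm ffactnSr natrM.
have [le_mx | lt_xm] := leqP m x; first by rewrite natrB.
by rewrite ffact_small // !mul0r.
Qed.

Lemma det_falling_perm (F : fieldType) n (b : 'I_n -> F) (e : 'I_n -> nat) (s : 'S_n) :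
  \det (falling_mx (b \o s) (e \o s)) = (-1) ^+ s * \det (falling_mx b e).
Proof.
rewrite -det_perm -det_mulmx -row_permE; congr (\det _).
by apply/matrixP => i j; rewrite !mxE.
Qed.

Lemma det_falling2 (F : fieldType) (b : 'I_2 -> F) (e : 'I_2 -> nat) :
  \det (falling_mx b e) =
    b ord0 * (e ord0)%:R - b (lift ord0 ord0) * (e (lift ord0 ord0))%:R.
Proof.
rewrite (expand_det_row _ ord0) !big_ord_recl big_ord0 addr0 /cofactor !det_mx11.
by rewrite !mxE /= /bump /= !expr0 !expr1 !ffactn1 !ffactn0 !mul1r !mulr1; ring.
Qed.

(** [beta ^ d] times the falling factorial of length [d] of [sg * 'X + x]: an
    entry of [falling_mx] in a row whose [e i] is an affine function of ['X]. *)
Definition falling_poly (F : fieldType) (beta sg x : F) (d : nat) : {poly F} :=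
  beta ^+ d *: \prod_(l < d) (sg *: 'X + (x - l%:R)%:P).

Lemma horner_falling_poly (F : fieldType) (beta sg x : F) (d u y : nat) :
  sg * u%:R + x = y%:R ->
  (falling_poly beta sg x d).[u%:R] = beta ^+ d * (y ^_ d)%:R.
Proof.
move=> ey; rewrite hornerZ horner_prod natr_ffact; congr (_ * _).
by apply: eq_bigr => l _; rewrite hornerD hornerZ hornerX hornerC addrA ey.
Qed.

Lemma falling_poly_top (F : fieldType) (beta sg x : F) (d : nat) :
  (size (falling_poly beta sg x d) <= d.+1)%N /\
  (falling_poly beta sg x d)`_d = beta ^+ d * sg ^+ d.
Proof.
rewrite /falling_poly; set g := \prod_(l < d) _.
suff [size_g top_g] : (size g <= d.+1)%N /\ g`_d = sg ^+ d.
  by split; [apply: leq_trans (size_scale_leq _ _) _|rewrite coefZ top_g].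
rewrite {}/g; elim: d => [|d [IHs IHc]]; first by rewrite big_ord0 size_poly1 coef1.
rewrite big_ord_recr /= mulrDr -scalerAr.
set g := \prod_(l < d) _ in IHs IHc *; split.
  apply: leq_trans (size_polyD _ _) _; rewrite geq_max; apply/andP; split.
    apply: leq_trans (size_scale_leq _ _) _.
    by apply: leq_trans (size_polyMleq _ _) _; rewrite size_polyX addn2.
  rewrite mulrC mul_polyC; apply: leq_trans (size_scale_leq _ _) _.
  exact: leqW.
by rewrite coefD coefZ coefMX /= IHc coefMC nth_default // mul0r addr0 exprS.
Qed.

(** * Determinants with two polynomial rows *)

Definition cons2 (T : Type) m (x y : T) (e : 'I_m -> T) (i : 'I_m.+2) : T :=
  if unlift ord0 i is Some i1 then (if unlift ord0 i1 is Some i2 then e i2 else y)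
  else x.

Definition two_rows (T : Type) m (p q : 'I_m.+2 -> T) (c : 'I_m -> 'I_m.+2 -> T) :
    'M[T]_m.+2 :=
  \matrix_(i, j) cons2 (p j) (q j) (c^~ j) i.

(** Two successive row expansions: the polynomial rows only meet the constants
    coming from the minors of the other rows. *)
Lemma det_two_rows (F : fieldType) m (p q : 'I_m.+2 -> {poly F})
    (c : 'I_m -> 'I_m.+2 -> F) :
  \det (two_rows p q (fun i j => (c i j)%:P)) =
  \sum_(j < m.+2) \sum_(j' < m.+1) (-1) ^+ (j + j') *
    (p j * q (lift j j') * (\det (\matrix_(i, l) c i (lift j (lift j' l))))%:P).
Proof.
rewrite (expand_det_row _ ord0); apply: eq_bigr => j _.
rewrite mxE /cons2 unlift_none /cofactor (expand_det_row _ ord0) !big_distrr /=.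
apply: eq_bigr => j' _; rewrite !mxE /cons2 liftK unlift_none /cofactor !add0n exprD.
rewrite -det_map_mx; set d := \det _; set d' := \det _.
suff -> : d = d' by ring.
by congr (\det _); apply/matrixP => i l; rewrite !mxE /cons2 !liftK.
Qed.

Lemma size_two_rows_term (F : fieldType) m (p q : 'I_m.+2 -> {poly F}) (k : F)
    (j : 'I_m.+2) (j' : 'I_m.+1) :
    (forall j, size (p j) <= m.+2 - j)%N -> (forall j, size (q j) <= m.+2 - j)%N ->
  (size ((-1) ^+ (j + j') * (p j * q (lift j j') * k%:P))%R <=
    m.*2.+3 - (j + lift j j'))%N.
Proof.
move=> sp sq; rewrite -signr_odd mulr_sign.
have -> : size (if odd (j + j') then - (p j * q (lift j j') * k%:P)
    else p j * q (lift j j') * k%:P)%R = size (k *: (p j * q (lift j j'))).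
  by rewrite mulrC mul_polyC; case: ifP; rewrite ?size_polyN.
apply: leq_trans (size_scale_leq _ _) _; apply: leq_trans (size_polyMleq _ _) _.
move: (sp j) (sq (lift j j')) (ltn_ord j) (ltn_ord (lift j j')).
move: (size _) (size _) (nat_of_ord (lift j j')) (nat_of_ord j) => x y u v; lia.
Qed.

Lemma size_det_two_rows (F : fieldType) m (p q : 'I_m.+2 -> {poly F})
    (c : 'I_m -> 'I_m.+2 -> F) :
    (forall j, size (p j) <= m.+2 - j)%N -> (forall j, size (q j) <= m.+2 - j)%N ->
  (size (\det (two_rows p q (fun i j => (c i j)%:P))) <= m.*2.+2)%N.
Proof.
move=> sp sq; rewrite det_two_rows.
apply: (leq_trans (size_sum _ _ _)); apply/bigmax_leqP => j _.
apply: (leq_trans (size_sum _ _ _)); apply/bigmax_leqP => j' _.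
apply: (leq_trans (size_two_rows_term _ _ _ sp sq)).
(* two distinct columns have indices of sum at least 1 *)
by move: (neq_lift j j'); rewrite -val_eqE /=; lia.
Qed.

Lemma coefM_top (R : nzRingType) (f g : {poly R}) s t :
  (size f <= s.+1)%N -> (size g <= t.+1)%N -> (f * g)`_(s + t) = f`_s * g`_t.
Proof.
move=> sf sg; rewrite coefM (bigD1 (inord s)) //= inordK ?ltnS ?leq_addr //.
rewrite addKn big1 ?addr0 // => i.
rewrite -val_eqE /= inordK ?ltnS ?leq_addr // => ne_is.
have [lt_is|ge_is] := ltnP i s.
  have -> : g`_(s + t - i) = 0 by apply: nth_default; apply: leq_trans sg _; lia.
  by rewrite mulr0.
have -> : f`_i = 0 by apply: nth_default; apply: leq_trans sf _; lia.
by rewrite mul0r.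
Qed.

(** Under these degree bounds a product of entries in columns [l] and [l'] has
    degree at most [2 m + 2 - (l + l')], so only the first two columns
    contribute to the coefficient of degree [2 m + 1]. *)
Lemma coef_det_two_rows (F : fieldType) m (p q : 'I_m.+2 -> {poly F})
    (c : 'I_m -> 'I_m.+2 -> F) :
    (forall j, size (p j) <= m.+2 - j)%N -> (forall j, size (q j) <= m.+2 - j)%N ->
  let i0 := ord0 in let i1 := lift ord0 ord0 in
  (\det (two_rows p q (fun i j => (c i j)%:P)))`_(m.*2.+1) =
    ((p i0)`_m.+1 * (q i1)`_m - (p i1)`_m * (q i0)`_m.+1)
    * \det (\matrix_(i, j) c i (lift ord0 (lift ord0 j))).
Proof.
move=> sp sq i0 i1; rewrite det_two_rows.
have small (j : 'I_m.+2) (j' : 'I_m.+1) k : (1 < j + lift j j')%N ->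
  ((-1) ^+ (j + j') * (p j * q (lift j j') * k%:P))`_(m.*2.+1) = 0.
  move=> lt1; apply/nth_default/(leq_trans (size_two_rows_term _ _ _ sp sq)).
  by lia.
rewrite coef_sum 2!big_ord_recl [X in _ + (_ + X)]big1 ?addr0; last first.
  move=> j _; rewrite coef_sum big1 // => j' _; apply: small.
  by rewrite /= /bump; lia.
rewrite !coef_sum !big_ord_recl !big1 ?addr0; first last.
- by move=> j' _; apply: small; rewrite /= /bump /=; lia.
- by move=> j' _; apply: small; rewrite /= /bump /=; lia.
rewrite -/i0 -/i1; have -> : lift i1 ord0 = i0 :> 'I_m.+2 by apply: val_inj.
rewrite addn0 expr0 mul1r expr1 mulN1r coefN !coefMC.
have -> : \matrix_(i, l) c i (lift i1 (lift ord0 l))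
        = \matrix_(i, l) c i (lift i0 (lift ord0 l)).
  by apply/matrixP => i l; rewrite !mxE; congr (c i _); apply: val_inj.
rewrite -!mulNr -mulrDl; congr (_ * _).
have -> : m.*2.+1 = (m.+1 + m)%N by lia.
by rewrite (coefM_top (sp i0) (sq i1)) addnC (coefM_top (sp i1) (sq i0)) mulNr.
Qed.

(** * Exponents with a nonzero determinant *)

Lemma natr_inj_pchar (F : fieldType) p (charF : p \in [pchar F]) (x y : nat) :
  (x < p)%N -> (y < p)%N -> x%:R = y%:R :> F -> x = y.
Proof.
wlog le_xy : x y / (x <= y)%N => [wl x_p y_p exy|x_p y_p exy].
  by have [/wl|/ltnW/wl] := leqP x y => wl'; [exact: wl'|exact/esym/wl'].
have : (p %| y - x)%N by rewrite (dvdn_pcharf charF) natrB // exy subrr.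
have [|lt0 /(dvdn_leq lt0)] := posnP (y - x)%N; lia.
Qed.

(** The first two exponents are [u] and [s - u].  Seen as a polynomial in [u],
    the determinant is nonzero of degree [2 m + 1], hence it cannot vanish at
    [2 m + 2] consecutive integers, which remain distinct below the
    characteristic. *)
Lemma falling_step (F : fieldType) p (charF : p \in [pchar F]) m
    (b : 'I_m.+2 -> F) (e : 'I_m -> nat) (s lo : nat) :
    b ord0 != 0 -> b (lift ord0 ord0) != 0 -> b ord0 + b (lift ord0 ord0) != 0 ->
    \det (falling_mx (fun i => b (lift ord0 (lift ord0 i))) e) != 0 ->
    (lo + m.*2.+1 <= s)%N -> (lo + m.*2.+1 < p)%N ->
  exists2 u, (lo <= u <= lo + m.*2.+1)%N &
    \det (falling_mx b (cons2 u (s - u)%N e)) != 0.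
Proof.
move=> b0 b1 b01 de le_s lt_p.
pose i0 : 'I_m.+2 := ord0; pose i1 : 'I_m.+2 := lift ord0 ord0.
(* the row of e 0 = 'X, the row of e 1 = s - 'X, and the constant rows *)
pose row0 (j : 'I_m.+2) := falling_poly (b i0) 1 0 (rev_ord j).
pose row1 (j : 'I_m.+2) := falling_poly (b i1) (-1) s%:R (rev_ord j).
pose M := two_rows row0 row1 (fun i j =>
  (b (lift ord0 (lift ord0 i)) ^+ rev_ord j * (e i ^_ rev_ord j)%:R)%:P).
have evalM u : (u <= s)%N ->
    (\det M).[u%:R] = \det (falling_mx b (cons2 u (s - u)%N e)).
  move=> le_us; rewrite -[LHS]/(horner_eval u%:R _) -det_map_mx.
  congr (\det _); apply/matrixP => i j; rewrite !mxE /horner_eval /cons2.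
  case: unliftP => [i' ->|->]; last by apply: horner_falling_poly; ring.
  case: unliftP => [i'' ->|->]; first exact: hornerC.
  by apply: horner_falling_poly; rewrite natrB //; ring.
have size_row (be sg x : F) (j : 'I_m.+2) :
    (size (falling_poly be sg x (rev_ord j)) <= m.+2 - j)%N.
  have [/leq_trans -> //] := falling_poly_top be sg x (rev_ord j).
  by have := ltn_ord j; rewrite /=; lia.
have coef_row (be sg x : F) (j : 'I_m.+2) (d : nat) : d = rev_ord j ->
    (falling_poly be sg x (rev_ord j))`_d = be ^+ d * sg ^+ d.
  by move=> ->; have [] := falling_poly_top be sg x (rev_ord j).
have sizeM : (size (\det M) <= m.*2.+2)%N.
  by apply: size_det_two_rows => j; exact: size_row.
have coefM : (\det M)`_(m.*2.+1) != 0.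
  rewrite coef_det_two_rows; [|by move=> j; exact: size_row..].
  have i0E : m.+1 = rev_ord i0 :> nat by rewrite /= subn1.
  have i1E : m = rev_ord i1 :> nat by rewrite /= /bump /=; lia.
  rewrite /row0 /row1 !(coef_row _ _ _ _ _ i0E, coef_row _ _ _ _ _ i1E).
  rewrite !expr1n !mulr1; apply: mulf_neq0; last exact: de.
  rewrite (_ : _ - _ = (b i0 * b i1 * (-1)) ^+ m * (b i0 + b i1)); last first.
    by rewrite !exprS !exprMn; ring.
  by rewrite mulf_neq0 // expf_neq0 // !mulf_neq0 // oppr_eq0 oner_eq0.
have M0 : \det M != 0 by apply: contraNneq coefM => ->; rewrite coef0.
pose rs : seq F := [seq (lo + t)%:R | t <- iota 0 m.*2.+2].
have urs : uniq rs.
  rewrite map_inj_in_uniq ?iota_uniq // => t t'.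
  rewrite !mem_iota => t_lt t'_lt /(natr_inj_pchar charF) eq_t.
  by apply/eqP; rewrite -(eqn_add2l lo); apply/eqP/eq_t; lia.
have /allPn[_ /mapP[t tI ->] nr] : ~~ all (root (\det M)) rs.
  apply/negP => all_r; have := max_poly_roots M0 all_r urs.
  by rewrite size_map size_iota ltnNge sizeM.
move: tI; rewrite mem_iota => tI.
exists (lo + t)%N; first lia.
by rewrite -evalM //; lia.
Qed.

Lemma exponents_step (F : fieldType) p (charF : p \in [pchar F]) m k s
    (b : 'I_m.+2 -> F) (e : 'I_m -> nat) :
    (forall i, b i != 0) -> b ord0 + b (lift ord0 ord0) != 0 ->
    (k <= p)%N -> (m.*2.+1 <= s)%N -> (s + m.*2.+1 <= k.-1.*2)%N ->
    (forall i, (e i < k)%N) ->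
    \det (falling_mx (fun i => b (lift ord0 (lift ord0 i))) e) != 0 ->
  exists e' : 'I_m.+2 -> nat, [/\ forall i, (e' i < k)%N,
    (\sum_i e' i = s + \sum_i e i)%N & \det (falling_mx b e') != 0].
Proof.
move=> b0 b01 k_p s_lo s_hi e_k de.
(* lo is the least u for which s - u does not exceed k - 1 *)
have [||u u_lohi du] :=
  falling_step (s := s) (lo := s - k.-1) charF (b0 _) (b0 _) b01 de.
- lia.
- lia.
exists (cons2 u (s - u)%N e); split=> //.
  move=> i; rewrite /cons2; case: unliftP => [i' _|_]; last lia.
  by case: unliftP => [i'' _|_]; [exact: e_k|lia].
rewrite !big_ord_recl /cons2 !(liftK, unlift_none) addnA; congr (_ + _)%N; first lia.
by apply: eq_bigr => i _; rewrite !liftK.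
Qed.

(** If [b 0 + b 1], [b 0 + b 2] and [b 2 + b 1] all vanished, then so would
    [2 * b 0]. *)
Lemma pair_sum_neq0 (F : fieldType) m (b : 'I_m.+3 -> F) :
    2%:R != 0 :> F -> (forall i, b i != 0) ->
  exists s : 'S_m.+3, b (s ord0) + b (s (lift ord0 ord0)) != 0.
Proof.
move=> two0 b0; pose i0 : 'I_m.+3 := ord0.
pose i1 : 'I_m.+3 := lift ord0 ord0.
pose i2 : 'I_m.+3 := lift ord0 (lift ord0 ord0).
have [s01|] := eqVneq (b i0 + b i1) 0; last by exists 1%g; rewrite !perm1.
have [s02|] := eqVneq (b i0 + b i2) 0; last first.
  by exists (tperm i1 i2); rewrite tpermD // tpermL.
have [s12|] := eqVneq (b i2 + b i1) 0; last first.
  by exists (tperm i0 i2); rewrite tpermL tpermD.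
have : 2%:R * b i0 = 0.
  have -> : 2%:R * b i0 = (b i0 + b i1) + (b i0 + b i2) - (b i2 + b i1) by ring.
  by rewrite s01 s02 s12 addr0 subr0.
by move/eqP; rewrite mulf_eq0 (negPf two0) (negPf (b0 i0)).
Qed.

(** The bounds on [S] are the sums of [n] distinct exponents, least and
    greatest: when all [b i] are equal, only distinct exponents give a nonzero
    determinant.  The last hypothesis concerns two opposite coefficients left
    over at the end.  The induction takes away as much of [S] as possible, so
    that the sum left for them is either [1] or
    [2 k - 3 - (n (k - 1) - 'C(n, 2) - S)]; the hypothesis makes the latter
    smaller than [p]. *)
Lemma exists_exponents (F : fieldType) p (charF : p \in [pchar F])
    (p_gt2 : (2 < p)%N) n k S (b : 'I_n -> F) (b0 : forall i, b i != 0) :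
    (0 < n)%N -> (0 < k)%N -> (n.-1.*2 <= k)%N -> (k <= p)%N ->
    ('C(n, 2) <= S)%N -> (S + 'C(n, 2) <= n * k.-1)%N ->
    (S + 'C(n, 2) + k.*2 < p + n * k.-1 + 3)%N ->
  exists e : 'I_n -> nat, [/\ forall i, (e i < k)%N, (\sum_i e i)%N = S
    & \det (falling_mx b e) != 0].
Proof.
have two0 : 2%:R != 0 :> F.
  by rewrite -(dvdn_pcharf charF); apply/negP => /dvdn_leq; lia.
elim/ltn_ind: n k S b b0 => -[|[|[|m]]] IH // k S b b0 _ k0 n_k k_p S_lo S_hi S_p.
- exists (fun=> S); rewrite big_ord1 [falling_mx _ _]mx11_scalar det_scalar1 !mxE /=.
  rewrite expr0 mul1r oner_neq0; split=> //.
  by move: S_hi; rewrite bin_small //; lia.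
- rewrite binn in S_lo S_hi S_p.
  (* opposite coefficients leave the determinant b 0 * S *)
  have [b01|b01] := eqVneq (b ord0 + b (lift ord0 ord0)) 0.
    exists (cons2 (S - k.-1)%N (S - (S - k.-1))%N (fun=> 0%N)); split.
    + move=> i; rewrite /cons2; case: unliftP => [i' _|_]; last by lia.
      by case: unliftP => [[]//|_]; lia.
    + by rewrite !big_ord_recl big_ord0 /cons2 !(liftK, unlift_none); lia.
    rewrite det_falling2 /cons2 !(liftK, unlift_none).
    have -> : b (lift ord0 ord0) = - b ord0.
      by apply/eqP; rewrite -addr_eq0 addrC b01.
    rewrite mulNr opprK -mulrDr -natrD subnKC ?leq_subr // mulf_neq0 //.
    by rewrite -(dvdn_pcharf charF); apply/negP => /dvdn_leq; lia.
  have [|||e [ek eS de]] :=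
    exponents_step (m := 0) (e := fun=> 0%N) charF b0 b01 k_p S_lo.
  + lia.
  + by [].
  + by rewrite det_mx00 oner_neq0.
  by exists e; rewrite eS big_ord0 addn0.
set n := m.+1 in IH *.
have binS2 q : 'C(q.+1, 2) = ('C(q, 2) + q)%N by rewrite binS bin1.
have binE : 'C(n.+2, 2) = ('C(n, 2) + n.*2.+1)%N by rewrite !binS2; lia.
rewrite binE in S_lo S_hi S_p.
have [s bs] := pair_sum_neq0 two0 b0.
(* the sum of the first two exponents: as large as exponents_step and the
   remaining rows allow *)
pose t := minn (k.*2 - n.*2 - 3) (S - 'C(n, 2)).
have bin2n : ('C(n, 2) + 'C(n, 2) = n * m)%N.
  by rewrite addnn /n; elim: (m) => // q IHq; rewrite binS2 doubleD IHq; lia.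
have k_n : (n.*2 + 2 <= k)%N by move: n_k; rewrite /n /=; lia.
have nm_k : (n * m + k.-1 <= n * k.-1 + 1)%N.
  have [d kE] : exists d, k.-1 = (m + d.+1)%N.
    by exists (k.-1 - m.+1)%N; move: k_n; rewrite /n; lia.
  rewrite kE mulnDr /n !mulSn mulnS; lia.
have nS_k : (n.+2 * k.-1 = n * k.-1 + k.-1.*2)%N by lia.
rewrite nS_k in S_hi S_p.
have b0s i : (b \o s) i != 0 by exact: b0.
have t_lo : (n.*2.+1 <= t)%N by rewrite /t leq_min; apply/andP; split; lia.
have t_hi : (t + n.*2.+1 <= k.-1.*2)%N by rewrite /t; lia.
have t_S : ('C(n, 2) <= S - t)%N by rewrite /t; lia.
have [] := IH n _ k (S - t)%N (fun i => b (s (lift ord0 (lift ord0 i))))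
  (fun i => b0 _) => //.
- by rewrite /n; lia.
- move: nm_k bin2n S_hi k_n t_S; rewrite /t /minn.
  move: (n * k.-1)%N (n * m)%N 'C(n, 2) => P Q c; clear; case: ifP; lia.
- move: nm_k bin2n S_p k_p k_n t_S; rewrite /t /minn.
  move: (n * k.-1)%N (n * m)%N 'C(n, 2) => P Q c; clear; case: ifP; lia.
move=> e [ek eS de].
have [e' [e'k e'S de']] :=
  exponents_step (b := b \o s) charF b0s bs k_p t_lo t_hi ek de.
exists (e' \o (s^-1)%g); split=> [i||].
- exact: e'k.
- rewrite (reindex_inj (@perm_inj _ s)) /= -(@subnKC t S); last first.
    by rewrite /t; lia.
  by rewrite -eS -e'S; apply: eq_bigr => i _; rewrite permK.
have := det_falling_perm b (e' \o (s^-1)%g) s.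
rewrite (_ : falling_mx (b \o s) _ = falling_mx (b \o s) e'); last first.
  by apply/matrixP => i j; rewrite !mxE /= permK.
by move=> dE; apply: contraNneq de' => d0; rewrite dE d0 mulr0.
Qed.

(** * Coefficients extracted by evaluation on a grid *)

(** The weights of the divided difference at [e + 1] points of [A], which
    extracts the coefficient of degree [e] of a polynomial of degree at
    most [e]. *)
Lemma divided_difference (F : finFieldType) (A : {set F}) e : (e < #|A|)%N ->
  exists w : F -> F, (forall y, y \notin A -> w y = 0) /\
    (forall m, (m <= e)%N -> \sum_y w y * y ^+ m = (m == e)%:R).
Proof.
move=> lt_eA; pose v (j : 'I_e.+1) : F := enum_val (widen_ord lt_eA j).
have v_inj : injective v by move=> i j /enum_val_inj /(congr1 val) /= /ord_inj.
pose V := Vandermonde e.+1 (\row_j v j).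
have uV : V \in unitmx.
  rewrite unitmxE det_Vandermonde unitfE; apply/prodf_neq0 => i _.
  apply/prodf_neq0 => j lt_ij; rewrite !mxE subr_eq0.
  by apply: contraTneq lt_ij => /v_inj->; rewrite ltnn.
pose W : 'cV_e.+1 := invmx V *m delta_mx ord_max 0.
exists (fun y => \sum_j (v j == y)%:R * W j 0); split=> [y yA|m le_me].
  apply: big1 => j _; case: eqP => [vy|_]; last by rewrite mul0r.
  by case/negP: yA; rewrite -vy enum_valP.
under eq_bigr do rewrite big_distrl.
rewrite exchange_big /=.
have /(congr1 (fun M : 'cV_e.+1 => M (inord m) 0)) : V *m W = delta_mx ord_max 0.
  by rewrite mulKVmx.
rewrite !mxE eqxx andbT -val_eqE /= inordK // => <-.
apply: eq_bigr => j _; rewrite (bigD1 (v j)) //= big1 => [|y yj].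
  by rewrite eqxx mul1r addr0 !mxE inordK // mulrC.
by rewrite eq_sym (negPf yj) !mul0r.
Qed.

Lemma leq_sum_eq (I : finType) (f g : I -> nat) :
  (forall i, f i <= g i)%N -> (\sum_i g i <= \sum_i f i)%N -> f =1 g.
Proof.
move=> le_fg le_sum i; apply/eqP; rewrite eqn_leq le_fg /=.
have := le_sum; rewrite (bigD1 i) //= [X in (_ <= X)%N](bigD1 i) //=.
have : (\sum_(j | j != i) f j <= \sum_(j | j != i) g j)%N by exact: leq_sum.
lia.
Qed.

(** The product functional extracts the coefficient of [\prod_i x_i ^ e_i] from
    polynomials of at most the same total degree.  In that of
    [\prod_i x_i ^ m_i * (\sum_i a_i x_i - c) ^ N] only the multinomial term
    [N! / \prod_i (e_i - m_i)! * \prod_i a_i ^ (e_i - m_i)] survives;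
    multiplying by [\prod_i e_i !] turns it into falling factorials, which are
    zero when some [m_i] exceeds [e_i] and stay meaningful when [e_i !] is
    zero in the field. *)
Lemma tensor_moment (F : finFieldType) n (a : 'I_n -> F) (c : F) (e : 'I_n -> nat)
    (w : 'I_n -> F -> F) (a0 : forall i, a i != 0) :
    (forall i m, (m <= e i)%N -> \sum_y w i y * y ^+ m = (m == e i)%:R) ->
  forall N (m : 'I_n -> nat), (\sum_i m i + N <= \sum_i e i)%N ->
  (\prod_i (e i)`!%:R) * (\sum_(x : {ffun 'I_n -> F}) (\prod_i w i (x i)) *
    (\prod_i x i ^+ m i * (\sum_i a i * x i - c) ^+ N))
  = (\sum_i m i + N == \sum_i e i)%N%:R *
    (N`!%:R * \prod_i (a i ^+ e i * ((a i)^-1 ^+ m i * (e i ^_ m i)%:R))).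
Proof.
move=> hw; elim=> [|N IHN] m le_e.
  rewrite addn0 in le_e *.
  under [X in _ * X]eq_bigr do rewrite expr0 mulr1 -big_split.
  rewrite -(bigA_distr_bigA (fun i y => w i y * y ^+ m i)) /= -big_split /= mul1r.
  have [[i lt_i]|] := altP (@existsP _ (fun i => (m i < e i)%N)).
    rewrite (bigD1 i) //= hw 1?ltnW // (ltn_eqF lt_i) mulr0 mul0r.
    case: eqP => [eq_e|]; last by rewrite mul0r.
    have [j lt_j] : exists j, (e j < m j)%N.
      apply/existsP; apply: contraLR (lt_i); rewrite negb_exists -leqNgt.
      move=> /forallP ge_m.
      suff /(_ i) -> : m =1 e by rewrite leqnn.
      by apply: leq_sum_eq => [j|]; rewrite ?eq_e // leqNgt.
    by rewrite (bigD1 j) //= ffact_small // !mulr0 mul0r mulr0.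
  rewrite negb_exists => /forallP ge_m.
  have eq_m i : m i = e i.
    suff /(_ i) -> : e =1 m by [].
    by apply: leq_sum_eq => // j; rewrite leqNgt.
  rewrite (eq_bigr _ (fun i _ => eq_m i)) eqxx mul1r; apply: eq_bigr => i _.
  by rewrite eq_m hw // eqxx mulr1 ffactnn mulrA -exprMn mulfV // expr1n mul1r.
pose m' i j := (m j + (j == i))%N.
have sum_m' i : (\sum_j m' i j = (\sum_j m j).+1)%N.
  by rewrite big_split /= -big_mkcond /= big_pred1_eq addn1.
pose T i := a i ^+ e i * ((a i)^-1 ^+ m i * (e i ^_ m i)%:R).
(* multiply out one factor of the power *)
have -> : \sum_(x : {ffun 'I_n -> F}) (\prod_i w i (x i)) *
    (\prod_i x i ^+ m i * (\sum_i a i * x i - c) ^+ N.+1) =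
   \sum_i a i * (\sum_(x : {ffun 'I_n -> F}) (\prod_i w i (x i)) *
    (\prod_j x j ^+ m' i j * (\sum_i a i * x i - c) ^+ N)) -
    c * \sum_(x : {ffun 'I_n -> F}) (\prod_i w i (x i)) *
    (\prod_i x i ^+ m i * (\sum_i a i * x i - c) ^+ N).
  under [X in _ = X - _]eq_bigr do rewrite big_distrr.
  rewrite exchange_big big_distrr -sumrB /=; apply: eq_bigr => x _.
  set L := \sum_i a i * x i - c; rewrite exprS {1}/L mulrBl big_distrl /=.
  rewrite !mulrBr !big_distrr /=; congr (_ - _); last by ring.
  apply: eq_bigr => i _.
  have -> : \prod_j x j ^+ m' i j = x i * \prod_j x j ^+ m j.
    rewrite (bigD1 i) //= [in RHS](bigD1 i) //= /m' eqxx addn1 exprS mulrA.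
    by congr (_ * _); apply: eq_bigr => j /negPf->; rewrite addn0.
  by ring.
(* the constant c only meets a moment of too low degree *)
rewrite mulrBr big_distrr /= [X in _ - X](_ : _ = 0) ?subr0; last first.
  rewrite mulrCA IHN; last lia.
  by rewrite (_ : (_ == _) = false) ?mul0r ?mulr0 //; lia.
under eq_bigr => i _.
  rewrite mulrCA IHN; last by rewrite sum_m'; lia.
  rewrite sum_m' addSnnS.
  rewrite (_ : a i * _ = (\sum_i m i + N.+1 == \sum_i e i)%N%:R *
      (N`!%:R * (\prod_i T i * (e i - m i)%:R))); last first.
    rewrite mulrCA; congr (_ * _); rewrite mulrCA; congr (_ * _).
    rewrite (bigD1 i) //= [in RHS](bigD1 i) //= /T /m' eqxx addn1 exprS ffactnSr natrM.
    rewrite [in LHS](eq_bigr T); last by move=> j /negPf->; rewrite addn0.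
    by rewrite -/T; move: (a0 i) => ai0; field.
  over.
rewrite -!big_distrr /= -/T; case: eqP => [eq_e|_]; last by rewrite !mul0r.
rewrite !mul1r factS [(_ * N`!)%N]mulnC natrM -mulrA; congr (_ * _).
have [[i lt_i]|] := altP (@existsP _ (fun i => (e i < m i)%N)).
  have -> : \prod_i T i = 0.
    by rewrite (bigD1 i) //= {1}/T ffact_small // !mulr0 mul0r.
  by rewrite mulr0 mul0r.
rewrite negb_exists => /forallP le_m.
rewrite -natr_sum mulrC; congr (_%:R * _).
apply/eqP; rewrite -(eqn_add2l (\sum_i m i)) eq_e -big_split /=; apply/eqP.
by apply: eq_bigr => i _; rewrite subnKC // leqNgt.
Qed.

(** The polynomial method.  Otherwise [det (x_i ^ j) * ((L - c) ^ N - 1)], with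
    [L] the linear form, vanishes on the grid [A ^ n].  Expanding the Vandermonde
    determinant over permutations and taking the moment of each term makes its
    coefficient at the exponents [e] proportional to the determinant of
    [falling_mx]. *)
Lemma exists_pow_neq1 (F : finFieldType) (A : {set F}) n N (a : 'I_n -> F)
    (c : F) (e : 'I_n -> nat) :
    (forall i, a i != 0) -> (0 < N)%N -> N`!%:R != 0 :> F ->
    (forall i, e i < #|A|)%N -> (\sum_i e i = N + 'C(n, 2))%N ->
    \det (falling_mx (fun i => (a i)^-1) e) != 0 ->
  exists x : 'I_n -> F,
    [/\ injective x, forall i, x i \in A & (\sum_i a i * x i - c) ^+ N != 1].
Proof.
move=> a0 N_gt0 N_fact e_A e_sum de.
have [/existsP[x /and3P[/injectiveP x_inj /forallP xA Lx]]|no_x] := boolP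
  [exists x : {ffun 'I_n -> F}, [&& injectiveb x, [forall i, x i \in A]
     & (\sum_i a i * x i - c) ^+ N != 1]]; first by exists x.
case/negP: de; apply/eqP.
have /fin_all_exists[w /all_and2[w_A w_mom]] i := divided_difference (e_A i).
have mom := tensor_moment c a0 w_mom.
pose W (x : {ffun 'I_n -> F}) := \prod_i w i (x i).
pose L (x : {ffun 'I_n -> F}) := \sum_i a i * x i - c.
pose D (x : {ffun 'I_n -> F}) := \det (\matrix_(i, j) x i ^+ @rev_ord n j).
have zero x : W x * (D x * (L x ^+ N - 1)) = 0.
  have [xA|] := boolP [forall i, x i \in A]; last first.
    rewrite negb_forall => /existsP[i /w_A wi].
    by rewrite /W (bigD1 i) //= wi !mul0r.
  have [x_inj|] := boolP (injectiveb x); last first.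
    case/injectivePn => i [j ij xij].
    rewrite /D (determinant_alternate ij) ?mul0r ?mulr0 // => l.
    by rewrite !mxE xij.
  move: no_x; rewrite negb_exists => /forallP/(_ x).
  rewrite x_inj xA /= negbK.
  by move/eqP => Lx; rewrite /L Lx subrr !mulr0.
have rev_sum (s : 'S_n) : (\sum_i rev_ord (s i) = 'C(n, 2))%N.
  transitivity (\sum_(i < n) rev_ord i)%N.
    by rewrite [RHS](reindex_inj (@perm_inj _ s)).
  transitivity (\sum_(i < n) i)%N.
    by rewrite [RHS](reindex_inj rev_ord_inj).
  by rewrite -bin2_sum big_mkord.
have detE : \sum_x W x * (D x * (L x ^+ N - 1)) = \sum_(s : 'S_n) (-1) ^+ s *
   (\sum_x W x * (\prod_i x i ^+ rev_ord (s i) * L x ^+ N)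
    - \sum_x W x * (\prod_i x i ^+ rev_ord (s i) * L x ^+ 0)).
  under [RHS]eq_bigr do rewrite -sumrB big_distrr.
  rewrite exchange_big /=; apply: eq_bigr => x _.
  rewrite /D /determinant mulrC -mulrA big_distrl /=; apply: eq_bigr => s _.
  under eq_bigr do rewrite mxE.
  move: ((-1) ^+ s) (\prod_i _) (W x) (L x ^+ N) => sg P w' l.
  by rewrite (expr0 (L x)); ring.
(* the moments with L ^ 0 have too low a degree and vanish *)
move: detE; rewrite big1 //; move/esym/(congr1 (fun z => (\prod_i (e i)`!%:R) * z)).
rewrite mulr0 big_distrr /=.
under eq_bigr => s _.
  rewrite mulrCA mulrBr !mom ?rev_sum ?e_sum; try lia.
  rewrite addnC eqxx mul1r (_ : (_ == _) = false) ?mul0r ?subr0; last lia.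
  rewrite big_split /= mulrCA [X in _ * X]mulrCA.
  over.
rewrite -!big_distrr /= => /eqP.
rewrite !mulf_eq0 (negPf N_fact) /= => /orP[|/eqP dE].
  by apply: contraTeq => _; apply/prodf_neq0 => i _; rewrite expf_neq0.
rewrite -[RHS]dE; apply: eq_bigr => s _; congr (_ * _).
by apply: eq_bigr => i _; rewrite mxE.
Qed.

(** * Linear forms at distinct points *)

(** Here [N = p - 1]: a power [y ^ (p - 1)] differs from [1] only when [y] is
    zero, and [(p - 1)!] is invertible by Wilson's theorem. *)
Lemma linear_form_onto p (p_pr : prime p) (A : {set 'F_p}) n (a : 'I_n -> 'F_p)
    (e : 'I_n -> nat) (c : 'F_p) :
    (forall i, a i != 0) -> (forall i, e i < #|A|)%N ->
    (\sum_i e i = p.-1 + 'C(n, 2))%N ->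
    \det (falling_mx (fun i => (a i)^-1) e) != 0 ->
  exists x : 'I_n -> 'F_p,
    [/\ injective x, forall i, x i \in A & c = \sum_i a i * x i].
Proof.
move=> a0 e_A e_sum de.
have p1_gt0 : (0 < p.-1)%N by have := prime_gt1 p_pr; lia.
have p1_fact : (p.-1)`!%:R != 0 :> 'F_p.
  rewrite -(dvdn_pcharf (pchar_Fp p_pr)); apply/negP => p_fact.
  have := Wilson (prime_gt1 p_pr); rewrite p_pr -addn1 dvdn_addr // => /esym.
  by rewrite dvdn1; case: eqP p_pr => // ->.
have [x [x_inj xA Lx]] := exists_pow_neq1 c a0 p1_gt0 p1_fact e_A e_sum de.
exists x; split=> //; apply/eqP; rewrite eq_sym -subr_eq0; apply: contraNT Lx => Lx.
apply/eqP/(mulfI Lx); rewrite -exprS prednK ?prime_gt0 // mulr1.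
by rewrite -[in X in _ ^+ X](card_Fp p_pr) expf_card.
Qed.

(** For [k = 2 n + 1] the hypothesis only yields [p <= n (n + 1) + 2], and the
    bound is even while [p] is odd. *)
Lemma leq_pred_mul_half p k : prime p -> (7 < p)%N -> (4 * p <= k ^ 2 + 7)%N ->
  (2 < k %/ 2)%N /\ (p.-1 <= (k %/ 2) * (k - k %/ 2))%N.
Proof.
move=> p_pr p_gt7 le_k.
have p_odd : odd p by case: (even_prime p_pr) => // p2; move: p_gt7; rewrite p2.
set n := (k %/ 2)%N.
have [kE|kE] : (k = n.*2 \/ k = n.*2.+1)%N by rewrite /n; lia.
  rewrite kE in le_k *; have -> : (n.*2 - n = n)%N by lia.
  by split; nia.
rewrite kE in le_k *; have -> : (n.*2.+1 - n = n.+1)%N by lia.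
have le_p : (p <= n * n.+1 + 2)%N by nia.
have even_n : ~~ odd (n * n.+1 + 2) by rewrite oddD oddM /=; case: (odd n).
have ne_p : p != (n * n.+1 + 2)%N by apply: contraNneq even_n => <-.
split; last lia.
have lt_p : (p < n * n.+1 + 2)%N by rewrite ltn_neqAle ne_p.
rewrite ltnNge; apply/negP => n_le2.
by have : (n * n.+1 <= 2 * 3)%N; [exact: leq_mul|lia].
Qed.

Theorem corollary1p1 (R : rcfType) (p : nat) (hp : prime p) (hp7 : (7 < p)%N)
    (A : {set 'F_p}) (hA : Num.sqrt (4 * p%:R - 7) <= #|A|%:R :> R)
    (n : nat) (hn : n = (#|A| %/ 2)%N)
    (a : 'I_n -> 'F_p) (ha : forall i, a i != 0) (b : 'F_p) :
  exists x : 'I_n -> 'F_p,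
    [/\ injective x, forall i, x i \in A & b = \sum_(i < n) a i * x i].
Proof.
have le_k : (4 * p <= #|A| ^ 2 + 7)%N.
  have pos : 0 <= 4 * p%:R - 7 :> R.
    by rewrite subr_ge0 -natrM ler_nat; lia.
  rewrite -(ler_nat R) natrD natrM natrX -lerBlDr -[leLHS]sqr_sqrtr //.
  by rewrite ler_pXn2r // nnegrE ?sqrtr_ge0 ?ler0n.
have [n_gt2 p_le] := leq_pred_mul_half hp hp7 le_k; rewrite -hn in n_gt2 p_le.
have k_p : (#|A| <= p)%N by rewrite -[leqRHS](card_Fp hp) max_card.
have bin2n : ('C(n, 2) + 'C(n, 2) = n * n.-1)%N.
  by have := mul_bin_diag n 1; rewrite bin1; lia.
pose d := (#|A| - n)%N.
have [n_d d_n] : (n <= d)%N /\ (d <= n.+1)%N by rewrite /d hn; split; lia.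
have kE : (#|A| = n + d)%N by rewrite /d hn; lia.
have k1E : (n * #|A|.-1 = n * n.-1 + n * d)%N by rewrite -mulnDr; congr (_ * _)%N; lia.
have k_nd : (#|A|.*2 <= n * d + 3)%N.
  have : (3 * d <= n * d)%N by rewrite leq_mul2r n_gt2 orbT.
  have [n3|n_neq3] := eqVneq n 3; first by rewrite n3; lia.
  have : (4 * d <= n * d)%N by rewrite leq_mul2r; apply/orP; right; lia.
  lia.
have a0 i : (a i)^-1 != 0 by rewrite invr_eq0.
have [|||||||e [e_A e_sum de]] := exists_exponents (n := n) (k := #|A|)
   (S := (p.-1 + 'C(n, 2))%N) (pchar_Fp hp) (ltn_trans (isT : 2 < 7)%N hp7) a0.
- lia.
- lia.
- lia.
- exact: k_p.
- exact: leq_addl.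
- by rewrite k1E; lia.
- by rewrite k1E; lia.
exact: (linear_form_onto hp b ha e_A e_sum de).
Qed.
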